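(* Let $F_A$ be a free group in the alphabet $A$ and let $\kappa=|F_A|$. Then $F_A$ can be partitioned as $F_A=B_1\cup B_2$ (with $B_1\cap B_2=\varnothing$) so that neither $B_1$ nor $B_2$ is left $\kappa$-large.
   Context: For a group $G$ and a cardinal $\kappa\le|G|$, $[G]^{<\kappa}$ denotes the family of all subsets of $G$ of cardinality $<\kappa$. A subset $B$ of $G$ is called left $\kappa$-large if there exists $F\in[G]^{<\kappa}$ such that $G=FB$. *)

(* Defs.v *)
From HB Require Import structures.
From mathcomp Require Import all_boot.
From mathcomp Require Import boolp classical_sets functions cardinality.

Set Implicit Arguments.
Unset Strict Implicit.
Unset Printing Implicit Defensive.

Local Open Scope classical_set_scope.
Local Open Scope card_scope.
Local Open Scope group_scope.

Section FreeGroup.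
Variable A : choiceType.

(* The letter (a, true) stands for a and (a, false) for its formal inverse. *)
Definition letter : Type := (A * bool)%type.

Definition inv_letter (x : letter) : letter := (x.1, ~~ x.2).

Definition reduced (w : seq letter) : bool :=
  sorted (fun x y : letter => y != inv_letter x) w.

Definition cons_reduce (x : letter) (w : seq letter) : seq letter :=
  if w is y :: w' then if y == inv_letter x then w' else x :: w else [:: x].

(* For reduced v, this is the reduced form of the concatenation u ++ v. *)
Definition mul_word (u v : seq letter) : seq letter := foldr cons_reduce v u.

Definition inv_word (u : seq letter) : seq letter := rev (map inv_letter u).

Lemma inv_letterK : involutive inv_letter.
Proof. by case=> a b; rewrite /inv_letter /= negbK. Qed.

Lemma reduced_cons_reduce x w : reduced w -> reduced (cons_reduce x w).
Proof.
case: w => [|y w] //= red_w; case: eqVneq => [_|yx]; first exact: path_sorted red_w.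
by rewrite /= yx.
Qed.

Lemma reduced_mul u v : reduced v -> reduced (mul_word u v).
Proof. by move=> rv; elim: u => //= x u; apply: reduced_cons_reduce. Qed.

Lemma reduced_inv u : reduced u -> reduced (inv_word u).
Proof.
rewrite /reduced /inv_word rev_sorted sorted_map; apply: sub_sorted => x y /=.
by apply: contra => /eqP ->; rewrite inv_letterK.
Qed.

Lemma cons_reduceK x w : reduced w ->
  cons_reduce x (cons_reduce (inv_letter x) w) = w.
Proof.
case: w => [|y w] /=; first by rewrite eqxx.
rewrite inv_letterK; case: eqVneq => [->|_ _]; last by rewrite /= eqxx.
by case: w => [|z w] //= /andP[/negPf ->].
Qed.

Lemma mul_word_cons x v w : reduced w ->
  mul_word (cons_reduce x v) w = cons_reduce x (mul_word v w).
Proof.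
move=> rw; case: v => [|y v] //=; case: eqP => [->|_] //.
by rewrite cons_reduceK //; apply: reduced_mul.
Qed.

Lemma mul_wordA u v w : reduced w ->
  mul_word u (mul_word v w) = mul_word (mul_word u v) w.
Proof. by move=> rw; elim: u => //= x u ->; rewrite mul_word_cons. Qed.

Lemma mul_word_nil u : reduced u -> mul_word u [::] = u.
Proof.
elim: u => //= x u IHu red_xu; rewrite IHu; last exact: path_sorted red_xu.
by case: u red_xu {IHu} => //= y u /andP[/negPf ->].
Qed.

Lemma mul_inv_word u : mul_word (inv_word u) u = [::].
Proof.
elim: u => // x u IHu.
rewrite /inv_word /= rev_cons /mul_word foldr_rcons /= inv_letterK eqxx.
exact: IHu.
Qed.

Lemma inv_wordK : involutive inv_word.
Proof.
move=> u; rewrite /inv_word map_rev revK -map_comp -[RHS]map_id.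
by apply: eq_map; apply: inv_letterK.
Qed.

Record free_group : Type := FreeGroup { word : seq letter; wordP : reduced word }.

HB.instance Definition _ := [isSub for word].
HB.instance Definition _ := [Choice of free_group by <:].

Definition fg_one : free_group := @FreeGroup [::] isT.
Definition fg_inv (u : free_group) : free_group :=
  FreeGroup (reduced_inv (wordP u)).
Definition fg_mul (u v : free_group) : free_group :=
  FreeGroup (reduced_mul (word u) (wordP v)).

Lemma fg_mulA : associative fg_mul.
Proof. by move=> u v w; apply/val_inj/mul_wordA/wordP. Qed.

Lemma fg_mul1 : left_id fg_one fg_mul.
Proof. by move=> u; apply/val_inj. Qed.

Lemma fg_mulr1 : right_id fg_one fg_mul.
Proof. by move=> u; apply/val_inj/mul_word_nil/wordP. Qed.

Lemma fg_mulV : left_inverse fg_one fg_inv fg_mul.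
Proof. by move=> u; apply/val_inj/mul_inv_word. Qed.

Lemma fg_mulVr : right_inverse fg_one fg_inv fg_mul.
Proof.
move=> u; apply/val_inj; rewrite /= -{1}[word u]inv_wordK.
exact: mul_inv_word.
Qed.

HB.instance Definition _ :=
  isGroup.Build free_group fg_mulA fg_mul1 fg_mulr1 fg_mulV fg_mulVr.

End FreeGroup.

(* A cardinal is given by a set kappa of that cardinality, as in `#<=` and
   `#=`. *)
Definition card_lt (T U : Type) (X : set T) (kappa : set U) : Prop :=
  X #<= kappa /\ X #!= kappa.

Definition left_large (U : Type) (kappa : set U) (G : groupType) (B : set G) :
    Prop :=
  exists2 F : set G, card_lt F kappa & [set: G] = [set f * b | f in F & b in B].

(* Main.v *)
Require Import Defs.
From mathcomp Require Import all_boot.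
From mathcomp Require Import boolp classical_sets functions cardinality.

(** Let [B2] consist of the [b] for which [b^-1] does not start with an inverse
    letter, and let [B1] be the rest, i.e. the [b] for which [b^-1] starts with
    an inverse letter.  Suppose [F * B2] is the whole group and let [g] be a
    positive word.  Writing [g = f * b] gives [f = g * b^-1], and nothing
    cancels in this product, so the word of [f] starts with [g]: some element
    of [F] extends every prescribed positive word
    ([cover_meets_signed_prefixes]).  For [B1] the same holds with negative
    words.

    It remains to see that such an [F] has at least as many elements as the
    free group ([card_le_signed_prefixes]).  Many words [g] may be prefixes of
    the same [f], but if the alphabet has two letters, then the elements of the
    free group can be encoded by positive (or negative) words none of which is a
    prefix of another.  Then each [f] extends at most one code word, and
    decoding maps [F] onto the free group.  This replaces all cardinal
    arithmetic, in particular the equality of the cardinals of [F_A] and [A]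
    for infinite [A].  Over a single letter there is no such code, but
    the free group is countable, and [F], having words of unbounded length, is
    infinite.  Over the empty alphabet the group is trivial and [F], which
    extends the empty word, is nonempty. *)

Local Open Scope classical_set_scope.
Local Open Scope card_scope.

(** The empty word counts as having any required sign, so [s] is its default. *)
Definition head_sign {A : choiceType} (s : bool) (w : seq (letter A)) : bool :=
  if w is x :: _ then x.2 else s.

Definition signed_word {A : choiceType} (s : bool) (l : seq A) :
    seq (letter A) :=
  [seq (a, s) | a <- l].

Lemma reduced_signed_word {A : choiceType} s (l : seq A) :
  reduced (signed_word s l).
Proof.
case: l => [|a l] //; rewrite /reduced /=.
elim: l a => [|b l IHl] a //=; rewrite IHl andbT.
by rewrite xpair_eqE negb_and orbC; case: s {IHl}.
Qed.

(** Two letters of the same sign are never inverse to each other. *)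
Lemma mul_signed_word {A : choiceType} s (l : seq A) (v : seq (letter A)) :
  head_sign s v = s -> mul_word (signed_word s l) v = signed_word s l ++ v.
Proof.
move=> hv; elim: l => //= a l ->.
have: head_sign s (signed_word s l ++ v) = s by case: l.
case: (_ ++ _) => //= y w ys; case: eqP => // eqy.
by move: ys; rewrite eqy /=; case: s {hv eqy}.
Qed.

Definition meets_signed_prefixes {A : choiceType} s (F : set (free_group A)) :=
  forall l : seq A, exists2 f, F f & prefix (signed_word s l) (word f).

(** If the signed word [g] is [f * b], then [f = g * b^-1] without any
    cancellation. *)
Lemma cover_meets_signed_prefixes {A : choiceType} s (F B : set (free_group A)) :
    (forall b, B b -> head_sign s (word b^-1%g) = s) ->
    [set: free_group A] = [set (f * b)%g | f in F & b in B] ->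
  meets_signed_prefixes s F.
Proof.
move=> signB FB l; pose g := FreeGroup (reduced_signed_word s l).
have: [set (f * b)%g | f in F & b in B] g by rewrite -FB.
case=> f Ff [b Bb fbg]; exists f => //.
have -> : f = (g * b^-1)%g by rewrite -fbg mulgK.
rewrite [word _](mul_signed_word _ _ (word b^-1%g)) ?prefix_prefix //.
exact: signB.
Qed.

Section PrefixCode.
Variables (A : choiceType) (x y : A).
Hypothesis neq_yx : y != x.

(** A word becomes a list of blocks [y, x or y, a], one for each letter, of
    which the second entry records the sign; the terminator [x] differs from
    the start of every block, which makes the code prefix-free. *)
Definition encode (w : seq (letter A)) : seq A :=
  foldr (fun z l => [:: y, if z.2 then x else y, z.1 & l]) [:: x] w.

Fixpoint decode (l : seq A) : seq (letter A) :=
  match l with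
  | p :: q :: a :: l' => if p == x then [::] else (a, q == x) :: decode l'
  | _ => [::]
  end.

(** The arbitrary tail [t] expresses that the code is prefix-free: a list
    extends at most one code word, and [decode] finds it. *)
Lemma encodeK w t : decode (encode w ++ t) = w.
Proof.
elim: w => [|[a s] w IHw] /=; first by case: t => [|q [|a t]] //=; rewrite eqxx.
by rewrite (negPf neq_yx) IHw; case: s; rewrite ?eqxx ?(negPf neq_yx).
Qed.

Lemma card_le_signed_prefixes_neq s (F : set (free_group A)) :
  meets_signed_prefixes s F -> [set: free_group A] #<= F.
Proof.
move=> prefF.
pose h (f : free_group A) : free_group A :=
  insubd (fg_one A) (decode [seq z.1 | z <- word f]).
apply: card_le_trans (card_image_le h F); apply: subset_card_le => g _.
have [f Ff /prefixP[t def_f]] := prefF (encode (word g)).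
exists f => //; apply: val_inj; rewrite /h def_f map_cat -map_comp map_id.
by rewrite encodeK // valKd.
Qed.

End PrefixCode.

Lemma signed_prefixes_infinite {A : choiceType} s (a : A)
    (F : set (free_group A)) :
  meets_signed_prefixes s F -> infinite_set F.
Proof.
move=> prefF /finite_seqP[fs defF].
have [f Ff /prefixP[t def_f]] :=
  prefF (nseq (\max_(f <- fs) size (word f)).+1 a).
have: size (word f) <= \max_(f <- fs) size (word f).
  by apply: leq_bigmax_seq => //; move: Ff; rewrite defF.
by rewrite {1}def_f size_cat size_map size_nseq leqNgt leq_addr.
Qed.

(** Over a single letter a word is determined by its sequence of signs. *)
Lemma countable_free_group_subsingleton {A : choiceType} :
  (forall x y : A, x = y) -> countable [set: free_group A].
Proof.
move=> eqA; apply/countable_injP.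
exists (fun g => pickle [seq z.2 | z <- word g]) => g h _ _.
move=> /(pcan_inj pickleK) /(@inj_map _ _ snd) eq_gh; apply/val_inj/eq_gh.
by case=> a s [b r] /= ->; rewrite (eqA a b).
Qed.

Lemma card_le_signed_prefixes {A : choiceType} s (F : set (free_group A)) :
  meets_signed_prefixes s F -> [set: free_group A] #<= F.
Proof.
move=> prefF.
have [[x [y neq_yx]]|eqA] := pselect (exists x y : A, y != x).
  exact: card_le_signed_prefixes_neq _ x y neq_yx s F prefF.
have {}eqA (x y : A) : x = y.
  by apply/eqP/negP => /negP neq_xy; apply: eqA; exists y, x.
have [[a _]|noA] := pselect (exists a : A, True).
  apply: card_le_trans (countable_free_group_subsingleton eqA) _.
  exact/infiniteP/(signed_prefixes_infinite s a F prefF).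
(* Without letters, the empty word is the only one, and it lies in [F]. *)
have [f Ff _] := prefF [::].
apply: subset_card_le => g _; have -> // : g = f.
apply: val_inj; case: (val g) (val f) => [|[a r] u] [|[b t] v] //;
  by case: noA; (exists a || exists b).
Qed.

Lemma not_left_large_signed {A : choiceType} s (B : set (free_group A)) :
    (forall b, B b -> head_sign s (word b^-1%g) = s) ->
  ~ left_large [set: free_group A] B.
Proof.
move=> signB [F [_ /negP neF] FB]; apply: neF.
rewrite card_eq_le card_leT /=.
exact/(card_le_signed_prefixes s)/(cover_meets_signed_prefixes s F B).
Qed.

(* {classic A} is A itself, with a classical choiceType structure, so the
   alphabet is an arbitrary type. *)
Theorem theorem3 (A : Type) :
  exists B1 B2 : set (free_group {classic A}),
    [/\ [set: free_group {classic A}] = B1 `|` B2,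
        B1 `&` B2 = set0,
        ~ left_large [set: free_group {classic A}] B1 &
        ~ left_large [set: free_group {classic A}] B2].
Proof.
pose B2 : set (free_group {classic A}) :=
  [set b | head_sign true (word b^-1%g) = true].
exists (~` B2), B2; split.
- by rewrite setUC setUv.
- by rewrite setICl.
- apply: (not_left_large_signed false) => b; rewrite /B2 /=.
  by case: (inv_word _) => [|[a []] w].
- exact: (not_left_large_signed true).
Qed.
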